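(* Let $n\ge 2$ and $r\ge1$ be integers and let $s=\gcd(n-1,r+1)$. Then the corank of the $nr\times nr$ matrix $H_D$ is $$\operatorname{corank}(H_D)=s-1.$$
   Context: $N_r$ is the $r\times r$ matrix with all entries on and above the diagonal equal to $-1$ and all entries below the diagonal equal to $0$; $M_r=-N_r^t$. $H_D$ is the $nr\times nr$ integer skew-symmetric matrix consisting of $n\times n$ blocks of size $r\times r$, with diagonal blocks $0$, all blocks above the diagonal equal to $M_r$, and all blocks below the diagonal equal to $N_r$. The corank of a square matrix is the dimension of its kernel. *)

(* Defs.v *)
From HB Require Import structures.
From mathcomp Require Import all_boot all_order all_algebra.

Set Implicit Arguments.
Unset Strict Implicit.
Unset Printing Implicit Defensive.

Import GRing.Theory.
Local Open Scope ring_scope.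

Definition Nmx (r : nat) : 'M[int]_r :=
  \matrix_(i < r, j < r) (if (i <= j)%N then -1 else 0).

Definition Mmx (r : nat) : 'M[int]_r := - (Nmx r)^T.

Definition HD_block (n r : nat) (i j : 'I_n) : 'M[int]_r :=
  if (i < j)%N then Mmx r else if (j < i)%N then Nmx r else 0.

Lemma sum_block_sizes (n r : nat) : (\sum_(i < n) r = n * r)%N.
Proof. by rewrite sum_nat_const card_ord. Qed.

(* The library's block matrices have size \sum_(i < n) r; the cast only
   retypes this as n * r. *)
Definition HD (n r : nat) : 'M[int]_(n * r) :=
  castmx (sum_block_sizes n r, sum_block_sizes n r)
    (\mxblock_(i < n, j < n) HD_block r i j).

(* kermx is the left (row-vector) kernel, so the rows of kermx A^T span the
   usual kernel {v | A v = 0}. *)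
Definition corank (F : fieldType) (m : nat) (A : 'M[F]_m) : nat :=
  \rank (kermx A^T).

(* Main.v *)
(* Write a kernel vector of [H_D] as [n] blocks [x_0, ..., x_(n-1)] of size [r].
   Taking differences of the equations in both directions shows that each block
   is obtained from the previous one by the companion matrix of
   [1 + X + ... + X^r], i.e. by the cyclic shift on zero-sum vectors of length
   [r+1]. Hence [x_i(k) = a(i + (r-1-k))] for an [r+1]-periodic sequence [a]
   with zero sum over a period. The equations for [i = 0] say that all windows
   of length [n-1] of [a] have sum zero, so [a] is also [n-1]-periodic, and
   therefore [s]-periodic with zero sum over a period; such sequences form a
   space of dimension [s-1]. *)
Require Import Defs.
From HB Require Import structures.
From mathcomp Require Import all_boot all_order all_algebra.
From mathcomp Require Import zify lra.

Import GRing.Theory.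
Local Open Scope ring_scope.

(** * Periodic sequences and their window sums *)

Lemma periodicM {T : Type} {a : nat -> T} {p : nat} (q m : nat) :
  (forall m, a (m + p)%N = a m) -> a (m + q * p)%N = a m.
Proof.
move=> ap; elim: q => [|q IHq]; first by rewrite mul0n addn0.
by rewrite mulSn addnA addnAC ap.
Qed.

Lemma periodic_mod {T : Type} {a : nat -> T} {p : nat} (m : nat) :
  (forall m, a (m + p)%N = a m) -> a (m %% p)%N = a m.
Proof. by move=> ap; rewrite {2}(divn_eq m p) addnC periodicM. Qed.

(** Bezout without subtraction: some [gcdn p q + u * q] is a multiple of [p], so forward shifts
    suffice. *)
Lemma periodic_gcdn {T : Type} {a : nat -> T} {p q : nat} : (0 < p)%N ->
  (forall m, a (m + p)%N = a m) -> (forall m, a (m + q)%N = a m) ->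
  forall m, a (m + gcdn p q)%N = a m.
Proof.
move=> p_gt0 ap aq m; have [u _ /dvdnP [v def_v]] := Bezoutl q p_gt0.
by rewrite -(periodicM u _ aq) -addnA def_v (periodicM v _ ap).
Qed.

Lemma sum_window {V : nmodType} {a : nat -> V} {p : nat} (m : nat) :
  (forall m, a (m + p)%N = a m) ->
  \sum_(0 <= j < p) a (m + j)%N = \sum_(0 <= j < p) a j.
Proof.
move=> ap; elim: m => [|m IHm]; first by [].
rewrite -IHm; case: p => [|p] in ap IHm *; first by rewrite !big_nil.
rewrite big_nat_recr // [RHS]big_nat_recl //= addn0 addSnnS ap addrC.
by congr (_ + _); apply: eq_bigr => j _; rewrite addSnnS.
Qed.

Lemma sum_nat_shift {V : nmodType} (F : nat -> V) (m p : nat) :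
  \sum_(m <= j < p) F j = \sum_(0 <= j < p - m) F (m + j)%N.
Proof.
by rewrite -{1}[m]add0n big_addn; apply: eq_bigr => j _; rewrite addnC.
Qed.

Lemma sum_periods {V : nmodType} {a : nat -> V} {p : nat} (q : nat) :
  (forall m, a (m + p)%N = a m) ->
  \sum_(0 <= j < q * p) a j = (\sum_(0 <= j < p) a j) *+ q.
Proof.
move=> ap; elim: q => [|q IHq]; first by rewrite mul0n big_nil.
rewrite mulSn addnC (@big_cat_nat _ _ _ (q * p)) ?leq_addr //= IHq mulrSr.
by congr (_ + _); rewrite sum_nat_shift addKn sum_window.
Qed.

(** * From the kernel equations to a periodic sequence *)

(* The [k]-th coordinate of the [i]-th block of [H_D x = 0]. *)
Definition HD_eqn {R : nmodType} (n r : nat) (x : nat -> nat -> R) (i k : nat) :=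
  \sum_(i.+1 <= j < n) \sum_(0 <= l < k.+1) x j l =
  \sum_(0 <= j < i) \sum_(k <= l < r) x j l.

(** Subtracting the equations of blocks [i] and [i.+1] at [k = 0] leaves one entry against one full
    block sum: the nontrivial row of the companion matrix. [HD_eqn_shift] supplies the other
    rows. *)
Lemma HD_eqn_col0 {R : realDomainType} {n r : nat} {x : nat -> nat -> R} :
  (0 < r)%N -> (forall i k, (i < n)%N -> (k < r)%N -> HD_eqn n r x i k) ->
  forall i, (i.+1 < n)%N -> x i.+1 0%N = - \sum_(0 <= l < r) x i l.
Proof.
move=> r_gt0 eqx i ltin.
have := eqx i.+1 0%N ltin r_gt0; rewrite /HD_eqn [RHS]big_nat_recr //= => eq1.
have eq0 := eqx i 0%N (ltnW ltin) r_gt0.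
rewrite /HD_eqn big_ltn // big_nat1 in eq0.
by lra.
Qed.

(* Difference of the equations for k+1 and k. *)
Lemma HD_eqn_diff {R : realDomainType} {n r : nat} {x : nat -> nat -> R} :
  (forall i k, (i < n)%N -> (k < r)%N -> HD_eqn n r x i k) ->
  forall i k, (i < n)%N -> (k.+1 < r)%N ->
  \sum_(i.+1 <= j < n) x j k.+1 = - \sum_(0 <= j < i) x j k.
Proof.
move=> eqx i k ltin ltkr.
have := eqx i k ltin (ltnW ltkr); have := eqx i k.+1 ltin ltkr.
rewrite /HD_eqn (eq_bigr (fun j => \sum_(0 <= l < k.+1) x j l + x j k.+1)).
  rewrite [X in _ -> _ = X -> _](eq_bigr
    (fun j => x j k + \sum_(k.+1 <= l < r) x j l)).
    by rewrite !big_split /= => *; lra.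
  by move=> j _; rewrite big_ltn // ltnW.
by move=> j _; rewrite big_nat_recr.
Qed.

(** A second difference, this time of [HD_eqn_diff] in the block index. *)
Lemma HD_eqn_shift {R : realDomainType} {n r : nat} {x : nat -> nat -> R} :
  (forall i k, (i < n)%N -> (k < r)%N -> HD_eqn n r x i k) ->
  forall i k, (i.+1 < n)%N -> (k.+1 < r)%N -> x i.+1 k.+1 = x i k.
Proof.
move=> eqx i k ltin ltkr.
have := HD_eqn_diff eqx i.+1 k ltin ltkr; rewrite [in RHS]big_nat_recr //= => eq1.
have := HD_eqn_diff eqx i k (ltnW ltin) ltkr; rewrite big_ltn //= => eq0.
by lra.
Qed.

Lemma HD_eqn_row0 {R : realDomainType} {n r : nat} {x : nat -> nat -> R} :
  (forall i k, (i < n)%N -> (k < r)%N -> HD_eqn n r x i k) ->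
  forall k, (0 < n)%N -> (k < r)%N -> \sum_(1 <= j < n) x j k = 0.
Proof.
move=> eqx [|k] n_gt0 ltkr; last first.
  by rewrite (HD_eqn_diff eqx 0 k) // big_nil oppr0.
have := eqx 0%N 0%N n_gt0 ltkr; rewrite /HD_eqn [RHS]big_nil.
by under eq_bigr do rewrite big_nat1.
Qed.

Lemma HD_eqn_periodic {R : realDomainType} (p r : nat) (x : nat -> nat -> R) :
  (0 < p)%N -> (0 < r)%N ->
  (forall i k, (i < p.+1)%N -> (k < r)%N -> HD_eqn p.+1 r x i k) ->
  exists a : nat -> R,
    [/\ forall m, a (m + gcdn p r.+1)%N = a m,
        \sum_(0 <= j < gcdn p r.+1) a j = 0
      & forall i k, (i < p.+1)%N -> (k < r)%N -> x i k = a (i + (r.-1 - k))%N].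
Proof.
move=> p_gt0 r_gt0 eqx; set s := gcdn p r.+1.
(* One period of [a]: block 0 in reverse order, followed by the value at [r] that makes the period
   sum vanish. *)
pose b m := if (m < r)%N then x 0%N (r.-1 - m)%N
            else - \sum_(0 <= l < r) x 0%N l.
pose a m := b (m %% r.+1)%N.
have ar m : a (m + r.+1)%N = a m by rewrite /a modnDr.
have sum_r (m : nat) : \sum_(0 <= j < r.+1) a (m + j)%N = 0.
  rewrite sum_window // big_nat_recr //= {2}/a modn_small // /b ltnn.
  rewrite big_nat_rev big_nat; under eq_bigr => j /andP [_ ltjr].
    rewrite /a modn_small; last by lia.
    rewrite /b ifT; last by lia.
    rewrite (_ : r.-1 - _ = j)%N; last by lia.
  over.
  by rewrite -big_nat subrr.
have xa i k : (i < p.+1)%N -> (k < r)%N -> x i k = a (i + (r.-1 - k))%N.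
  elim: i k => [|i IHi] k ltip ltkr.
    rewrite add0n /a modn_small; last by lia.
    by rewrite /b ifT; [congr x | ]; lia.
  (* Coordinate 0 of block [i.+1] is [a (i + r)], the term that completes the reversed block [i] to
     a full period. *)
  case: k => [|k] in ltkr *; last first.
    by rewrite (HD_eqn_shift eqx) // IHi; [congr a; lia | lia | lia].
  rewrite (HD_eqn_col0 r_gt0 eqx) // big_nat.
  under eq_bigr => l /andP [_ ltlr] do rewrite (IHi _ (ltnW ltip)) //.
  rewrite -big_nat big_nat_rev big_nat.
  under eq_bigr => l /andP [_ ltlr].
    rewrite (_ : r.-1 - _ = l)%N; last by lia.
  over.
  rewrite -big_nat; have := sum_r i; rewrite big_nat_recr //= => sum0.
  by rewrite (_ : (_ + (_ - 0) = i + r)%N); [lra | lia].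
pose W m := \sum_(0 <= j < p) a (m + j)%N.
have W_r m : W (m + r.+1)%N = W m.
  by apply: eq_bigr => j _; rewrite addnAC ar.
(* The equations of block 0 give the windows starting at [r - k], hence every residue modulo [r.+1]
   except 0. The window at 0 follows because all [r.+1] windows together add up to [p] full
   periods. *)
have W_pos m : (0 < m <= r)%N -> W m = 0.
  move=> /andP [m_gt0 lemr]; rewrite -(HD_eqn_row0 eqx (r - m)%N) //; last by lia.
  rewrite big_add1 /= /W !big_nat; apply: eq_bigr => j /andP [_ ltjp].
  by rewrite xa; [congr a; lia | lia | lia].
have sumW : \sum_(0 <= m < r.+1) W m = 0.
  rewrite /W exchange_big /= big1 // => j _.
  by under eq_bigr do rewrite addnC; exact: sum_r.
have W_0 : W 0%N = 0.
  move: sumW; rewrite big_nat_recl // big_nat big1 ?addr0 // => m /andP [_ ltmr].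
  by apply: W_pos.
have W0 m : W m = 0.
  rewrite -(periodic_mod m W_r); have := ltn_pmod m (ltn0Sn r).
  by case: (m %% r.+1)%N => [|m'] // lem'r; apply: W_pos.
(* Consecutive windows differ by [a (m + p) - a m]. *)
have ap m : a (m + p)%N = a m.
  have := W0 m.+1; rewrite /W -[X in \sum_(_ <= _ < X) _](prednK p_gt0).
  rewrite big_nat_recr //= addSnnS prednK // => W1.
  have := W0 m; rewrite /W -[X in \sum_(_ <= _ < X) _](prednK p_gt0).
  rewrite big_nat_recl //= addn0.
  under eq_bigr do rewrite -addSnnS.
  by move=> *; lra.
have as_ m : a (m + s)%N = a m by exact: periodic_gcdn.
exists a; split=> //.
(* The zero sum over [r.+1] terms is [q] times the sum over [s] terms, and [q] is nonzero in
   characteristic 0. *)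
have /dvdnP [q def_q] := dvdn_gcdr p r.+1.
have := sum_r 0%N; rewrite (eq_bigr a) // def_q sum_periods //.
by case: q def_q => // q _ /eqP; rewrite Num.Theory.mulrn_eq0 => /eqP.
Qed.

(** * Periodic zero-sum sequences solve the equations *)

Lemma periodic_HD_eqn {R : realDomainType} (p r s : nat) (a : nat -> R) :
  (s %| p)%N -> (s %| r.+1)%N -> (forall m, a (m + s)%N = a m) ->
  \sum_(0 <= j < s) a j = 0 ->
  forall i k, (i < p.+1)%N -> (k < r)%N ->
  HD_eqn p.+1 r (fun i k => a (i + (r.-1 - k))%N) i k.
Proof.
move=> /dvdnP [u def_p] /dvdnP [v def_r] as_ sum0 i k ltip ltkr.
(* Both sides telescope in terms of the primitive [A], which is again periodic. *)
pose A m := \sum_(0 <= j < m) a j.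
have As m : A (m + s)%N = A m.
  rewrite /A (@big_cat_nat _ _ _ m) ?leq_addr //= -[RHS]addr0.
  by congr (_ + _); rewrite sum_nat_shift addKn sum_window // sum0.
have Ar m : A (m + r.+1)%N = A m by rewrite def_r (periodicM v m As).
have sumA m : \sum_(0 <= j < p) A (m + j)%N = \sum_(0 <= j < p) A j.
  by apply: sum_window => m'; rewrite def_p (periodicM u m' As).
have sum_a l m : (l <= m)%N -> \sum_(l <= j < m) a j = A m - A l.
  by move=> lelm; rewrite /A (@big_cat_nat _ _ _ l 0 m) //= [RHS]addrAC subrr add0r.
have lhs j : \sum_(0 <= l < k.+1) a (j.+1 + (r.-1 - l))%N =
    A j - A (r - k + j)%N.
  rewrite -[in RHS](Ar j) -sum_a; last by lia.
  rewrite [RHS]sum_nat_shift (_ : (j + r.+1 - _ = k.+1)%N); last by lia.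
  rewrite big_nat_rev !big_nat.
  by apply: eq_bigr => l /andP [_ ltlk]; congr a; lia.
have rhs j : \sum_(k <= l < r) a (j + (r.-1 - l))%N = A (r - k + j)%N - A j.
  rewrite -sum_a ?leq_addl // sum_nat_shift [RHS]sum_nat_shift addnK.
  rewrite big_nat_rev !big_nat.
  by apply: eq_bigr => l /andP [_ ltlk]; congr a; lia.
(* The two sides differ by the sum of [A j - A (r - k + j)] over all [j < p], which vanishes since
   [A] has period [p]. *)
rewrite /HD_eqn big_add1 /=.
under eq_bigr do rewrite lhs; under [RHS]eq_bigr do rewrite rhs.
rewrite !sumrB; have := sumA (r - k)%N.
rewrite !(@big_cat_nat _ _ _ i 0 p) //=.
by move=> *; lra.
Qed.

(** * Coordinates on periodic zero-sum sequences *)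

(* The [s]-periodic extension, in [m], of the basis vector [e_l - e_(s-1)] of the
   zero-sum hyperplane. *)
Definition zero_sum_coef (R : pzRingType) (s l m : nat) : R :=
  (m %% s == l)%N%:R - (m %% s == s.-1)%N%:R.

Definition zero_sum_ext {R : pzRingType} {s : nat} (w : 'rV[R]_s.-1) (m : nat) : R :=
  \sum_(l < s.-1) w 0 l * zero_sum_coef R s l m.

Lemma zero_sum_ext_periodic {R : pzRingType} {s : nat} (w : 'rV[R]_s.-1) m :
  zero_sum_ext w (m + s) = zero_sum_ext w m.
Proof. by rewrite /zero_sum_ext /zero_sum_coef modnDr. Qed.

Lemma zero_sum_extE {R : pzRingType} {s : nat} (w : 'rV[R]_s.-1) (l : 'I_s.-1) :
  zero_sum_ext w l = w 0 l.
Proof.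
have lts : (l < s)%N by have := ltn_ord l; lia.
rewrite /zero_sum_ext (bigD1 l) //= big1 => [|j /negPf neq_jl].
  by rewrite /zero_sum_coef modn_small // eqxx ltn_eqF // subr0 mulr1 addr0.
rewrite /zero_sum_coef modn_small // (ltn_eqF (ltn_ord l)).
by rewrite eq_sym (inj_eq val_inj) neq_jl subrr mulr0.
Qed.

Lemma sum_zero_sum_ext {R : pzRingType} {s : nat} (w : 'rV[R]_s.-1) :
  \sum_(0 <= m < s) zero_sum_ext w m = 0.
Proof.
rewrite exchange_big /= big1 // => l _; rewrite -mulr_sumr sumrB.
have sum1 k : (k < s)%N -> \sum_(0 <= m < s) (m %% s == k)%N%:R = 1 :> R.
  move=> ltks; rewrite big_mkord (bigD1 (Ordinal ltks)) //= modn_small // eqxx.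
  rewrite big1 ?addr0 // => j /negPf neq_jk.
  by rewrite modn_small // -[k]/(val (Ordinal ltks)) (inj_eq val_inj) neq_jk.
by rewrite !sum1 ?subrr ?mulr0 //; have := ltn_ord l; lia.
Qed.

Lemma zero_sum_ext_row {R : pzRingType} {s : nat} (a : nat -> R) m : (0 < s)%N ->
  (forall m, a (m + s)%N = a m) -> \sum_(0 <= j < s) a j = 0 ->
  zero_sum_ext (\row_(l < s.-1) a l) m = a m.
Proof.
move=> s_gt0 as_ sum0.
rewrite -(periodic_mod m (zero_sum_ext_periodic _)) -(periodic_mod m as_).
have := ltn_pmod m s_gt0; move: (m %% s)%N => {}m ltms.
have [ltms1 | lesm] := ltnP m s.-1.
  by rewrite (zero_sum_extE _ (Ordinal ltms1)) mxE.
(* At the last residue every coefficient is -1, and the zero-sum condition recovers [a s.-1]. *)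
have -> : m = s.-1 by lia.
rewrite /zero_sum_ext (eq_bigr (fun l : 'I_s.-1 => - a l)) => [|l _].
  move: sum0; rewrite -{1}(prednK s_gt0) big_nat_recr //= big_mkord sumrN.
  by move=> /eqP; rewrite addrC addr_eq0 => /eqP ->.
rewrite mxE /zero_sum_coef modn_small ?prednK // eqxx gtn_eqF //.
by rewrite sub0r mulrN1.
Qed.

(** * Block vectors indexed by natural numbers, and their product with [H_D] *)

Definition nat_mxrow {R : Type} (n r : nat) (x : nat -> nat -> R) :
  'rV[R]_(\sum_(i < n) r) := \mxrow_(i < n) \row_(k < r) x i k.

Lemma nat_mxrow_eqP {R : Type} (n r : nat) (x y : nat -> nat -> R) :
  (forall i k, (i < n)%N -> (k < r)%N -> x i k = y i k) <->
  nat_mxrow n r x = nat_mxrow n r y.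
Proof.
split=> [eqxy | eqxy i k ltin ltkr].
  by apply: eq_mxrow => i; apply/rowP => k; rewrite !mxE eqxy.
have := congr1 (fun v => submxrow v (Ordinal ltin) 0 (Ordinal ltkr)) eqxy.
by rewrite /nat_mxrow !mxrowK !mxE.
Qed.

Lemma nat_mxrow_surj {R : Type} (p q : nat) (v : 'rV[R]_(\sum_(i < p.+1) q.+1)) :
  exists x, v = nat_mxrow p.+1 q.+1 x.
Proof.
exists (fun i k => submxrow v (inord i) 0 (inord k)).
rewrite -[LHS]submxrowK; apply: eq_mxrow => i; apply/rowP => k.
by rewrite [RHS]mxE !inord_val.
Qed.

(** Blocks after [i] meet [Mmx], with 1 on and below the diagonal, giving sums over [l <= k]; blocks
    before [i] meet [Nmx], giving minus the sums over [l >= k]. *)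
Lemma mul_nat_mxrow_HD (R : realDomainType) (n r : nat) (x : nat -> nat -> R) :
  nat_mxrow n r x *m (map_mx intr (\mxblock_(i < n, j < n) HD_block r i j))^T =
  nat_mxrow n r (fun i k =>
    \sum_(i.+1 <= j < n) \sum_(0 <= l < k.+1) x j l -
    \sum_(0 <= j < i) \sum_(k <= l < r) x j l).
Proof.
have -> : (map_mx intr (\mxblock_(i < n, j < n) HD_block r i j))^T =
    \mxblock_(i < n, j < n) (map_mx intr (HD_block r j i))^T :> 'M[R]__.
  by apply/matrixP => i j; rewrite !mxE.
rewrite /nat_mxrow mul_mxrow_mxblock; apply: eq_mxrow => i; apply/rowP => k.
rewrite summxE [RHS]mxE big_geq_mkord big_mkord.
rewrite (big_ord_widen n (fun j => \sum_(k <= l < r) x j l)) 1?ltnW //.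
rewrite [X in X - _]big_mkcond [X in _ - X]big_mkcond -sumrB /=; apply: eq_bigr => j _.
rewrite big_mkord (big_ord_widen r (fun l => x j l)) // big_geq_mkord mxE /HD_block.
case: ltngtP => _; last by rewrite subrr big1 // => l _; rewrite !mxE mulr0.
- rewrite subr0 [RHS]big_mkcond; apply: eq_bigr => l _; rewrite !mxE ltnS.
  by case: leqP; rewrite ?opprK ?oppr0 ?mulr1 ?mulr0.
- rewrite sub0r -sumrN [RHS]big_mkcond; apply: eq_bigr => l _; rewrite !mxE.
  by case: leqP; rewrite ?rmorphN1 ?mulrN1 ?mulr0.
Qed.

Lemma HD_kerP (R : realDomainType) (n r : nat) (x : nat -> nat -> R) :
  nat_mxrow n r x *m (map_mx intr (\mxblock_(i < n, j < n) HD_block r i j))^T = 0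
  <-> forall i k, (i < n)%N -> (k < r)%N -> HD_eqn n r x i k.
Proof.
rewrite mul_nat_mxrow_HD.
have row0 : nat_mxrow n r (fun _ _ => 0 : R) = 0.
  by apply/matrixP => i j; rewrite !mxE.
split=> [|eqx]; last first.
  rewrite -[RHS]row0; apply/nat_mxrow_eqP => i k ltin ltkr.
  by rewrite eqx // subrr.
rewrite -[RHS]row0 => /nat_mxrow_eqP eqx i k ltin ltkr.
exact/subr0_eq/eqx.
Qed.

(** * A basis of the kernel, and the corank *)

Definition HD_ker_basis (R : pzRingType) (n r s : nat) :
    'M[R]_(s.-1, \sum_(i < n) r) :=
  \mxrow_(i < n) \matrix_(l, k) zero_sum_coef R s l (i + (r.-1 - k)).

Lemma mul_HD_ker_basis (R : pzRingType) (n r s : nat) (w : 'rV[R]_s.-1) :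
  w *m HD_ker_basis R n r s =
  nat_mxrow n r (fun i k => zero_sum_ext w (i + (r.-1 - k))).
Proof.
rewrite mul_mxrow; apply: eq_mxrow => i; apply/rowP => k; rewrite !mxE.
by apply: eq_bigr => l _; rewrite mxE.
Qed.

Lemma HD_ker_basis_free (F : fieldType) (p r s : nat) :
  (0 < r)%N -> (s <= p.+1)%N -> row_free (HD_ker_basis F p.+1 r s).
Proof.
move=> r_gt0 lesp; apply: inj_row_free => w; rewrite mul_HD_ker_basis => w0.
have /nat_mxrow_eqP ext0 : nat_mxrow p.+1 r
    (fun i k => zero_sum_ext w (i + (r.-1 - k))) = nat_mxrow p.+1 r (fun _ _ => 0).
  by rewrite w0; apply/matrixP => i j; rewrite !mxE.
(* The coordinate [w 0 l] is read off at position [r.-1] of block [l]; the bound on [s] ensures that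
   this block exists. *)
apply/rowP => l; rewrite mxE -zero_sum_extE -[in LHS](addn0 l).
by rewrite -(subnn r.-1) ext0 //; have := ltn_ord l; lia.
Qed.

Lemma corank_castmx (F : fieldType) (m m' : nat) (eq_m : m = m') (A : 'M[F]_m) :
  corank (castmx (eq_m, eq_m) A) = corank A.
Proof. by case: _ / eq_m; rewrite castmx_id. Qed.

Lemma corank_HD_blocks (R : realFieldType) (p q : nat) : (0 < p)%N ->
  corank (map_mx (intr : int -> R)
    (\mxblock_(i < p.+1, j < p.+1) HD_block q.+1 i j)) = (gcdn p q.+2).-1.
Proof.
move=> p_gt0; set s := gcdn p q.+2; rewrite /corank.
have s_gt0 : (0 < s)%N by rewrite gcdn_gt0 p_gt0.
have lesp : (s <= p.+1)%N by rewrite leqW // dvdn_leq // dvdn_gcdl.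
(* Replacing [s.-1] by the rank of the free matrix reduces the claim to two inclusions of row
   spaces. *)
rewrite -(eqP (HD_ker_basis_free R p q.+1 s _ lesp)) //.
apply/eqP; rewrite eqn_leq; apply/andP; split; apply/mxrankS/rV_subP => v.
  have [x ->] := nat_mxrow_surj p q v; move=> /sub_kermxP /HD_kerP.
  move=> /(HD_eqn_periodic p q.+1 x p_gt0 isT) [a [as_ sum0 xa]].
  apply/submxP; exists (\row_l a l); rewrite mul_HD_ker_basis.
  by apply/nat_mxrow_eqP => i k lti ltk; rewrite zero_sum_ext_row // xa.
move=> /submxP [w ->]; apply/sub_kermxP; rewrite mul_HD_ker_basis; apply/HD_kerP.
apply: (periodic_HD_eqn p q.+1 s); rewrite ?dvdn_gcdl ?dvdn_gcdr //.
  exact: zero_sum_ext_periodic.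
exact: sum_zero_sum_ext.
Qed.

Theorem proposition3p3 (n r : nat) (hn : (2 <= n)%N) (hr : (1 <= r)%N) :
  corank (map_mx (intr : int -> rat) (HD n r)) =
    (gcdn (n - 1) (r + 1) - 1)%N.
Proof.
rewrite /HD map_castmx corank_castmx.
case: n hn => [|p] // hp; case: r hr => [|q] // _.
by rewrite corank_HD_blocks // !subn1 addn1.
Qed.
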